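(* (Fixed Point Theorem) Let $\Pi$ be a set with a relation of betweenness, let $A,B\in\Pi$, and let $f:s[A,B]\to s[A,B]$ be a one-to-one function such that $f(s[C,D])=s[f(C),f(D)]$ for all points $C,D\in s[A,B]$. If the line segment $s[A,B]$ is connected, then $f$ has a fixed point.
   Context: A betweenness relation on a set $\Pi$ is a ternary relation ''$C$ is between $A$ and $B$'' such that, writing $s[A,B]$ for the set of all points between $A$ and $B$: (a) each point is between itself and any point of $\Pi$; (b) if $A$ is between $B$ and $C$, then $A$ is between $C$ and $B$; (c) if $C\in s[A,B]$, then $s[A,B]=s[A,C]\cup s[C,B]$ and $s[A,C]\cap s[C,B]=s[C,C]=\{C\}$. A closed line segment is a set of the form $s[A,B]$. A subset $S\subset\Pi$ is convex if $s[A,B]\subset S$ for all $A,B\in S$. A closed line segment $s[A,B]$ is connected if, whenever it is expressed as a union of two disjoint non-empty convex subsets, precisely one of these two subsets is a closed line segment. *)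

(* Defs.v *)
From mathcomp Require Import all_boot.
From mathcomp Require Import boolp classical_sets functions.

Set Implicit Arguments.
Unset Strict Implicit.
Unset Printing Implicit Defensive.

Local Open Scope classical_set_scope.

(* [btw C A B] reads "C is between A and B". *)
Definition segment (Pi : Type) (btw : Pi -> Pi -> Pi -> Prop) (A B : Pi) :
  set Pi := [set C | btw C A B].

Record betweenness (Pi : Type) (btw : Pi -> Pi -> Pi -> Prop) : Prop :=
  Betweenness {
    btw_refl : forall A B, btw A A B;
    btw_sym : forall A B C, btw A B C -> btw A C B;
    segment_split : forall A B C, segment btw A B C ->
      segment btw A B = segment btw A C `|` segment btw C B;
    segment_meet : forall A B C, segment btw A B C ->
      segment btw A C `&` segment btw C B = segment btw C C;
    segment_diag : forall A B C, segment btw A B C ->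
      segment btw C C = [set C]
  }.

Definition closed_segment (Pi : Type) (btw : Pi -> Pi -> Pi -> Prop)
  (S : set Pi) : Prop := exists A B, S = segment btw A B.

Definition convex_set (Pi : Type) (btw : Pi -> Pi -> Pi -> Prop)
  (S : set Pi) : Prop :=
  forall A B, S A -> S B -> segment btw A B `<=` S.

Definition connected_segment (Pi : Type) (btw : Pi -> Pi -> Pi -> Prop)
  (A B : Pi) : Prop :=
  forall S T : set Pi,
    convex_set btw S -> convex_set btw T -> S !=set0 -> T !=set0 ->
    S `&` T = set0 -> segment btw A B = S `|` T ->
    (closed_segment btw S /\ ~ closed_segment btw T) \/
    (~ closed_segment btw S /\ closed_segment btw T).

(* Main.v *)
(* Setting X <= Y iff X lies in s[A,Y] turns s[A,B] into a chain with least
   element A and greatest element B, whose order intervals are the segments.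
   Connectedness says that in every cut exactly one of the two parts has an
   extremum at the cut, so the chain is complete and densely ordered.  The map
   f is monotone or antitone.  In the monotone case the cut at the supremum of
   {x | x <= f x} gives a fixed point, as in the Knaster-Tarski theorem.  In the
   antitone case {x | x <= f x} and its complement form a cut; let c be its
   extremum, say c < f c.  Either y = f (f c) lies above c, or a point y strictly
   between c and f c lies in the interval from f (f c) to f c; in both cases
   y = f w for some w > c, hence y = f w <= w and f y <= y = f w <= f y. *)
Require Import Defs.
From mathcomp Require Import all_boot.
From mathcomp Require Import boolp classical_sets functions.

Local Open Scope classical_set_scope.

(** * Fixed points of maps of a chain *)

Record chain_on (T : Type) (I : set T) (le : T -> T -> Prop) : Prop := ChainOn {
  chain_trans : forall x y z, I x -> I y -> I z -> le x y -> le y z -> le x z;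
  chain_anti : forall x y, I x -> I y -> le x y -> le y x -> x = y;
  chain_total : forall x y, I x -> I y -> le x y \/ le y x
}.

Lemma chain_on_flip (T : Type) (I : set T) (le : T -> T -> Prop) :
  chain_on T I le -> chain_on T I (fun x y => le y x).
Proof.
case=> tr an tot; split=> /=.
- by move=> x y z Ix Iy Iz yx zy; exact: (tr z y x).
- by move=> x y Ix Iy yx xy; exact: an.
- by move=> x y Ix Iy; exact: tot.
Qed.

Definition greatest (T : Type) (le : T -> T -> Prop) (S : set T) (m : T) :=
  S m /\ forall x, S x -> le x m.

Definition least (T : Type) (le : T -> T -> Prop) (S : set T) (m : T) :=
  S m /\ forall x, S x -> le m x.

(** Order form of connectedness. On a chain, totality gives reflexivity, so the last condition on
    [S] and [U] places [S] strictly below [U] and makes them disjoint. The alternative excludes gaps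
    (neither extremum exists) and jumps (both exist). *)
Definition cut_connected (T : Type) (I : set T) (le : T -> T -> Prop) :=
  forall S U : set T, S !=set0 -> U !=set0 -> I = S `|` U ->
    (forall x y, S x -> U y -> ~ le y x) ->
    (exists m, greatest T le S m) /\ ~ (exists m, least T le U m) \/
    ~ (exists m, greatest T le S m) /\ (exists m, least T le U m).

Lemma monotone_fixed_point (T : Type) (I : set T) (le : T -> T -> Prop)
    (a b : T) (f : T -> T) :
  chain_on T I le -> cut_connected T I le -> I a -> I b ->
  (forall x, I x -> le a x) -> (forall x, I x -> le x b) -> set_fun I I f ->
  (forall x y, I x -> I y -> le x y -> le (f x) (f y)) ->
  exists2 p, I p & f p = p.
Proof.
move=> [tr an tot] cut Ia Ib lea leb fI mono.
have refl x : I x -> le x x by move=> Ix; case: (tot x x Ix Ix).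
(* The down-closure of the points with [x <= f x], so that [S] and [U] form a cut. *)
pose S := [set x | I x /\ exists y, [/\ I y, le x y & le y (f y)]].
pose U := [set x | I x /\ ~ S x].
case: (pselect (S b)) => [[_ [y [Iy by_ yf]]]|nSb].
  have e : y = b by apply: an => //; apply: leb.
  by exists y => //; apply: an => //; [exact: fI|rewrite {2}e; apply/leb/fI].
have IE : I = S `|` U.
  apply/seteqP; split=> x; last by case=> [[]|[]].
  by move=> Ix; case: (pselect (S x)); [left|right].
have low x y : S x -> U y -> ~ le y x.
  move=> [Ix [z [Iz xz zf]]] [Iy nSy] yx; apply: nSy; split=> //.
  by exists z; split=> //; exact: (tr y x z).
have Sa : S a by split=> //; exists a; split; [|exact: refl|exact/lea/fI].
have Ub : U b by [].
have {cut low IE} [[[m [Sm mmax]] _]|[_ [m [[Im nSm] mmin]]]] :=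
  cut S U (ex_intro _ a Sa) (ex_intro _ b Ub) IE low.
  (* The witness [y] with [m <= y <= f y] lies in [S], hence equals [m]; then [f m] is in [S] by
     monotonicity, so [f m <= m]. *)
  have [Im [y [Iy my yf]]] := Sm.
  have ym : le y m by apply: mmax; split=> //; exists y; split=> //; exact: refl.
  have e : y = m by exact: an.
  subst y; exists m => //; apply: an => //; first exact: fI.
  apply: mmax; split; first exact: fI.
  have Ifm : I (f m) by exact: fI.
  by exists (f m); split; [|exact: refl|exact: mono].
have nmf : ~ le m (f m).
  by move=> mf; apply: nSm; split=> //; exists m; split=> //; exact: refl.
have Ifm : I (f m) by exact: fI.
(* If [f m] were in [U], minimality would give [m <= f m]. So [f m <= y <= f y] for some [y], with
   [y <= m] because [m] is not in [S]; then [f y <= f m <= y]. *)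
case: (pselect (S (f m))) => [[_ [y [Iy fy yf]]]|nSf]; last first.
  by case: nmf; apply: mmin.
have ym : le y m.
  case: (tot y m Iy Im) => // my; case: nSm; split=> //.
  by exists y.
have Ify : I (f y) by exact: fI.
exists y => //; apply: an => //.
by apply: (tr _ (f m)) => //; exact: mono.
Qed.

(** Treats one side of the cut only; reversing [le] gives the other. On the chain, [~ le x c] means
    that [x] is strictly above [c], and the last hypothesis says that no point follows [c]
    immediately. *)
Lemma antitone_fixed_point_right (T : Type) (I : set T) (le : T -> T -> Prop)
    (f : T -> T) (c : T) :
  chain_on T I le -> set_fun I I f ->
  (forall x y, I x -> I y -> le x y -> le (f y) (f x)) ->
  (forall z, I z -> le (f (f c)) z -> le z (f c) ->
     exists w, [/\ I w, le c w & f w = z]) ->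
  I c -> le c (f c) -> (forall x, I x -> ~ le x c -> le (f x) x) ->
  (forall t, I t -> ~ le t c -> exists y, [/\ I y, ~ le y c & ~ le t y]) ->
  exists2 p, I p & f p = p.
Proof.
move=> [tr an tot] fI anti ivt Ic cf right dense.
have Ifc : I (f c) by exact: fI.
have Iffc : I (f (f c)) by exact: fI.
case: (pselect (f c = c)) => [e|fc_neq]; first by exists c.
have nfc : ~ le (f c) c by move=> fc; apply/fc_neq/an.
have ffc := right _ Ifc nfc.
case: (pselect (f (f c) = f c)) => [e|ffc_neq]; first by exists (f c).
have [y [Iy nyc yfc yneq ffy]] :
    exists y, [/\ I y, ~ le y c, le y (f c), y <> f c & le (f (f c)) y].
  case: (pselect (le (f (f c)) c)) => [ffcc|]; last first.
    by exists (f (f c)); split=> //; case: (tot _ _ Iffc Iffc).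
  have [y [Iy nyc nfy]] := dense _ Ifc nfc.
  exists y; split=> //.
  - by case: (tot y (f c) Iy Ifc).
  - by move=> e; apply: nfy; rewrite e; case: (tot _ _ Ifc Ifc).
  - by apply: (tr _ c) => //; case: (tot y c Iy Ic).
have [w [Iw cw fw]] := ivt y Iy ffy yfc.
(* Since [f w = y] differs from [f c], [w] is not [c], so [right] applies to [w]. *)
have nwc : ~ le w c.
  by move=> wc; apply: yneq; rewrite -fw; congr f; exact: an.
have yw : le y w by have := right w Iw nwc; rewrite fw.
have Ify : I (f y) by exact: fI.
exists y => //; apply: an => //; first exact: right.
by have := anti y w Iy Iw yw; rewrite fw.
Qed.

Lemma antitone_fixed_point (T : Type) (I : set T) (le : T -> T -> Prop)
    (a b : T) (f : T -> T) :
  chain_on T I le -> cut_connected T I le -> I a -> I b ->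
  (forall x, I x -> le a x) -> (forall x, I x -> le x b) -> set_fun I I f ->
  (forall x y, I x -> I y -> le x y -> le (f y) (f x)) ->
  (forall x y z, I x -> I y -> I z -> le x y -> le (f y) z -> le z (f x) ->
     exists w, [/\ I w, le x w, le w y & f w = z]) ->
  exists2 p, I p & f p = p.
Proof.
move=> ch cut Ia Ib lea leb fI anti ivt.
have [tr an tot] := ch.
(* This set is already closed downwards: [y <= x] gives [y <= x <= f x <= f y]. *)
pose S := [set x | I x /\ le x (f x)].
pose U := [set x | I x /\ ~ le x (f x)].
case: (pselect (le b (f b))) => [bf|nbf].
  have Ifb : I (f b) by exact: fI.
  by exists b => //; apply: an => //; exact: leb.
have IE : I = S `|` U.
  apply/seteqP; split=> x; last by case=> [[]|[]].
  by move=> Ix; case: (pselect (le x (f x))); [left|right].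
have low x y : S x -> U y -> ~ le y x.
  move=> [Ix xf] [Iy nyf] yx; apply: nyf.
  have Ifx : I (f x) by exact: fI.
  have Ify : I (f y) by exact: fI.
  apply: (tr _ x) => //; apply: (tr _ (f x)) => //; exact: anti.
have Sa : S a by split=> //; exact/lea/fI.
have Ub : U b by [].
have {cut IE} [[[c [[Ic cf] cmax]] nmin]|[nmax [d [[Id ndf] dmin]]]] :=
  cut S U (ex_intro _ a Sa) (ex_intro _ b Ub) IE low.
- have Ifc : I (f c) by exact: fI.
  have outS x : I x -> ~ le x c -> ~ le x (f x).
    by move=> Ix nxc xf; apply/nxc/cmax.
  apply: (antitone_fixed_point_right T I le f c) => //.
  + move=> z Iz ffz zf.
    by have [w [Iw cw _ fw]] := ivt c (f c) z Ic Ifc Iz cf ffz zf; exists w.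
  + move=> x Ix /(outS x Ix) nxf.
    by have := fI x Ix; move=> Ifx; case: (tot x (f x) Ix Ifx).
  (* With no point strictly between [c] and [t], [t] would be least in [U], which is excluded
     because [S] has a greatest element. *)
  + move=> t It /(outS t It) ntf; apply: contrapT => nex.
    apply: nmin; exists t; split=> // y Uy; apply: contrapT => nty.
    apply: nex; exists y; split=> //; first by case: Uy.
    exact: (low c y).
- have Ifd : I (f d) by exact: fI.
  have fd : le (f d) d by case: (tot d (f d) Id Ifd).
  have outU x : I x -> ~ le d x -> le x (f x).
    by move=> Ix ndx; apply: contrapT => nxf; apply/ndx/dmin.
  (* In the reversed order, [d] is the greatest element of [U] and [f] is still antitone. *)
  apply: (antitone_fixed_point_right T I (fun x y => le y x) f d) => //.
  + exact: chain_on_flip.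
  + by move=> x y Ix Iy yx; exact: anti.
  + move=> z Iz zff fz.
    by have [w [Iw _ wd fw]] := ivt (f d) d z Ifd Id Iz fd fz zff; exists w.
  + move=> t It /(outU t It) tf; apply: contrapT => nex.
    apply: nmax; exists t; split=> // y Sy; apply: contrapT => nyt.
    apply: nex; exists y; split=> //; first by case: Sy.
    exact: (low y d).
Qed.

(** * Segments as intervals of a chain *)

Lemma segment_sym (Pi : Type) (btw : Pi -> Pi -> Pi -> Prop) (A B : Pi) :
  betweenness btw -> segment btw A B = segment btw B A.
Proof. by move=> h; apply/seteqP; split=> x; exact: (btw_sym h). Qed.

Lemma segment_left (Pi : Type) (btw : Pi -> Pi -> Pi -> Prop) (A B : Pi) :
  betweenness btw -> segment btw A B A.
Proof. by move=> h; exact: (btw_refl h). Qed.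

Lemma segment_right (Pi : Type) (btw : Pi -> Pi -> Pi -> Prop) (A B : Pi) :
  betweenness btw -> segment btw A B B.
Proof. by move=> h; rewrite segment_sym//; exact: segment_left. Qed.

Lemma segment_subl (Pi : Type) (btw : Pi -> Pi -> Pi -> Prop) (A B C : Pi) :
  betweenness btw -> segment btw A B C -> segment btw A C `<=` segment btw A B.
Proof. by move=> h ABC x ACx; rewrite (segment_split h ABC); left. Qed.

Lemma segment_meet_eq (Pi : Type) (btw : Pi -> Pi -> Pi -> Prop)
    (A B C X : Pi) :
  betweenness btw -> segment btw A B C ->
  segment btw A C X -> segment btw C B X -> X = C.
Proof.
move=> h ABC ACX CBX.
have : (segment btw A C `&` segment btw C B) X by [].
by rewrite (segment_meet h ABC) (segment_diag h ABC).
Qed.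

(** Totality: splitting at [X] and at [Y], incomparable points would satisfy [X] in s[Y,B] and [Y]
    in s[X,B], which forces [X = Y]. *)
Lemma segment_chain (Pi : Type) (btw : Pi -> Pi -> Pi -> Prop) (A B : Pi) :
  betweenness btw ->
  chain_on Pi (segment btw A B) (fun X Y => segment btw A Y X).
Proof.
move=> h; split=> /=.
- move=> X Y Z _ _ _ XY YZ; exact: (segment_subl _ _ _ _ _ h YZ).
- move=> X Y _ _ XY YX.
  apply/esym/(segment_meet_eq _ _ _ _ _ _ h XY YX); exact: segment_right.
- move=> X Y IX IY.
  have := IX; rewrite (segment_split h IY) => -[|YBX]; first by left.
  have := IY; rewrite (segment_split h IX) => -[|XBY]; first by right.
  rewrite (segment_meet_eq _ _ _ _ _ _ h YBX (segment_left _ _ _ _ h) XBY).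
  by left; exact: segment_right.
Qed.

(** Splitting s[A,D] at [C] gives s[A,C] and s[C,D], which share only [C]. *)
Lemma segment_itv (Pi : Type) (btw : Pi -> Pi -> Pi -> Prop) (A B C D : Pi) :
  betweenness btw -> segment btw A B D -> segment btw A D C ->
  segment btw C D = [set X | segment btw A X C /\ segment btw A D X].
Proof.
move=> h ID CD; apply/seteqP; split=> X /=.
  move=> CDX; have DX : segment btw A D X by rewrite (segment_split h CD); right.
  split=> //.
  have [IX IC] : segment btw A B X /\ segment btw A B C.
    by split; exact: (segment_subl _ _ _ _ _ h ID).
  case: (chain_total _ _ _ (segment_chain _ _ A B h) C X IC IX) => //= CX.
  by rewrite (segment_meet_eq _ _ _ _ _ _ h CD CX CDX); exact: segment_right.
move=> [CX]; rewrite (segment_split h CD) => -[ACX|//].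
rewrite (segment_meet_eq _ _ _ _ _ _ h CX ACX (segment_right _ _ _ _ h)).
exact: segment_left.
Qed.

Lemma closed_segment_extrema (Pi : Type) (btw : Pi -> Pi -> Pi -> Prop)
    (A B : Pi) (S : set Pi) :
  betweenness btw -> S `<=` segment btw A B -> closed_segment btw S ->
  (exists m, greatest Pi (fun X Y => segment btw A Y X) S m) /\
  (exists m, least Pi (fun X Y => segment btw A Y X) S m).
Proof.
move=> h SI [C [D eS]].
wlog CD : C D eS / segment btw A D C.
  move=> H.
  have IC : segment btw A B C by apply: SI; rewrite eS; exact: segment_left.
  have ID : segment btw A B D by apply: SI; rewrite eS; exact: segment_right.
  case: (chain_total _ _ _ (segment_chain _ _ A B h) C D IC ID) => /= CD.
    exact: (H C D).
  by apply: (H D C) => //; rewrite segment_sym.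
have ID : segment btw A B D by apply: SI; rewrite eS; exact: segment_right.
split; [exists D|exists C]; split.
- by rewrite eS; exact: segment_right.
- by move=> X; rewrite eS (segment_itv _ _ _ _ _ _ h ID CD) => -[].
- by rewrite eS; exact: segment_left.
- by move=> X; rewrite eS (segment_itv _ _ _ _ _ _ h ID CD) => -[].
Qed.

(** Both parts of a cut are convex. The lower part is a segment exactly when it has a greatest
    element [m], being then s[A,m]; dually, the upper part is s[m,B] for its least element [m]. *)
Lemma connected_segment_cut (Pi : Type) (btw : Pi -> Pi -> Pi -> Prop)
    (A B : Pi) :
  betweenness btw -> connected_segment btw A B ->
  cut_connected Pi (segment btw A B) (fun X Y => segment btw A Y X).
Proof.
move=> h hconn S U S0 U0 IE low.
have [tr an tot] := segment_chain _ _ A B h.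
have SI : S `<=` segment btw A B by rewrite IE; left.
have UI : U `<=` segment btw A B by rewrite IE; right.
have IA : segment btw A B A by exact: segment_left.
have Sdown X Y : S Y -> segment btw A Y X -> S X.
  move=> SY YX; have : segment btw A B X.
    exact: (segment_subl _ _ _ _ _ h (SI _ SY)).
  by rewrite IE => -[//|UX]; case: (low Y X).
have Uup X Y : U X -> segment btw A B Y -> segment btw A Y X -> U Y.
  by move=> UX; rewrite IE => -[SY|//] YX; case: (low Y X).
have Sconv : convex_set btw S.
  move=> C D SC SD.
  wlog CD : C D SC SD / segment btw A D C.
    move=> H; case: (tot C D (SI _ SC) (SI _ SD)) => CD; first exact: H.
    by rewrite segment_sym//; exact: H.
  rewrite (segment_itv _ _ _ _ _ _ h (SI _ SD) CD) => X [_ XD].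
  exact: (Sdown X D).
have Uconv : convex_set btw U.
  move=> C D UC UD.
  wlog CD : C D UC UD / segment btw A D C.
    move=> H; case: (tot C D (UI _ UC) (UI _ UD)) => CD; first exact: H.
    by rewrite segment_sym//; exact: H.
  rewrite (segment_itv _ _ _ _ _ _ h (UI _ UD) CD) => X [CX XD].
  apply: (Uup C X) => //; exact: (segment_subl _ _ _ _ _ h (UI _ UD)).
have SU0 : S `&` U = set0.
  apply/seteqP; split=> // X [SX UX]; apply: (low X X) => //.
  exact: segment_right.
have Sseg : closed_segment btw S <->
    exists m, greatest Pi (fun X Y => segment btw A Y X) S m.
  split=> [/(closed_segment_extrema _ _ A B S h SI)[]//|[m [Sm mmax]]].
  exists A, m; apply/seteqP; split=> X; first exact: mmax.
  exact: Sdown.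
have Useg : closed_segment btw U <->
    exists m, least Pi (fun X Y => segment btw A Y X) U m.
  split=> [/(closed_segment_extrema _ _ A B U h UI)[]//|[m [Um mmin]]].
  exists m, B; have IB : segment btw A B B by exact: segment_right.
  rewrite (segment_itv _ _ _ _ _ _ h IB (UI _ Um)).
  apply/seteqP; split=> X; first by move=> UX; split; [exact: mmin|exact: UI].
  by move=> [mX IX]; exact: (Uup m X).
by rewrite -Sseg -Useg; exact: hconn.
Qed.

(* f : s[A,B] -> s[A,B] is a map of the ambient type used only on s[A,B]. *)
Theorem theorem3p10 (Pi : Type) (btw : Pi -> Pi -> Pi -> Prop)
    (hbtw : betweenness btw) (A B : Pi) (f : Pi -> Pi)
    (f_fun : set_fun (segment btw A B) (segment btw A B) f)
    (f_inj : set_inj (segment btw A B) f)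
    (f_seg : forall C D : Pi, segment btw A B C -> segment btw A B D ->
       f @` segment btw C D = segment btw (f C) (f D))
    (hconn : connected_segment btw A B) :
  exists2 P : Pi, segment btw A B P & f P = P.
Proof.
have ch := segment_chain _ _ A B hbtw.
have cut := connected_segment_cut _ _ _ _ hbtw hconn.
have IA : segment btw A B A by exact: segment_left.
have IB : segment btw A B B by exact: segment_right.
have IfA := f_fun A IA; have IfB := f_fun B IB.
have img C D X : segment btw A B C -> segment btw A B D ->
    segment btw C D X -> segment btw (f C) (f D) (f X).
  by move=> IC ID CDX; rewrite -(f_seg C D IC ID); exists X.
(* The order of [f A] and [f B] decides the direction of [f]: first [f Y] lies between them, then
   [f X] lies between [f A] and [f Y]. *)
case: (chain_total _ _ _ ch _ _ IfA IfB) => /= fAB.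
  apply: (monotone_fixed_point _ _ _ A B f ch cut IA IB) => //.
    by move=> X _; exact: segment_left.
  move=> X Y IX IY XY; have IfY := f_fun Y IY.
  have : segment btw (f A) (f B) (f Y) by exact: img.
  rewrite (segment_itv _ _ _ _ _ _ hbtw IfB fAB) => -[fAY _].
  have : segment btw (f A) (f Y) (f X) by exact: img.
  by rewrite (segment_itv _ _ _ _ _ _ hbtw IfY fAY) => -[].
have anti X Y : segment btw A B X -> segment btw A B Y -> segment btw A Y X ->
    segment btw A (f X) (f Y).
  move=> IX IY XY; have IfY := f_fun Y IY.
  have : segment btw (f A) (f B) (f Y) by exact: img.
  rewrite segment_sym// (segment_itv _ _ _ _ _ _ hbtw IfA fAB) => -[_ fYA].
  have : segment btw (f A) (f Y) (f X) by exact: img.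
  by rewrite segment_sym// (segment_itv _ _ _ _ _ _ hbtw IfA fYA) => -[].
apply: (antitone_fixed_point _ _ _ A B f ch cut IA IB) => //.
  by move=> X _; exact: segment_left.
move=> X Y Z IX IY IZ XY YZ ZX.
have : segment btw (f Y) (f X) Z.
  have fYX := anti X Y IX IY XY.
  by rewrite (segment_itv _ _ _ _ _ _ hbtw (f_fun X IX) fYX).
(* The image of s[X,Y] is the whole segment from [f X] to [f Y], which provides the preimage [W] of
   [Z]. *)
rewrite segment_sym// -(f_seg X Y IX IY) => -[W XYW fW].
have [XW WY] : segment btw A W X /\ segment btw A Y W.
  by move: XYW; rewrite (segment_itv _ _ _ _ _ _ hbtw IY XY).
by exists W; split=> //; exact: (segment_subl _ _ _ _ _ hbtw IY).
Qed.
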